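(* There exist functions $F(m,n,c)$ and $D(n,c)$ with positive integer values such that the following holds. Suppose that a locally finite group $G$ contains an element $g$ of order $2^n$ with finite centralizer of order $m=|C_G(g)|$ such that the centralizer $C_G(g^{2^{n-1}})$ of the involution $g^{2^{n-1}}$ is nilpotent of class $c$. Then $G$ has a characteristic soluble subgroup of finite index at most $F(m,n,c)$ that has derived length at most $D(n,c)$.
   Context: Here $n\geqslant 1$. A group is locally finite if every finitely generated subgroup of it is finite. $C_G(x)$ denotes the centralizer of the element $x$ in $G$. *)

(* Defs.v *)
From mathcomp Require Import all_boot.
From mathcomp Require Import boolp classical_sets functions cardinality.

Set Implicit Arguments.
Unset Strict Implicit.
Unset Printing Implicit Defensive.

Local Open Scope classical_set_scope.
Local Open Scope group_scope.

(* Groups are arbitrary, possibly infinite, [groupType]s; subgroups are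
   classical sets. *)

Definition is_subgroup (G : groupType) (H : set G) : Prop :=
  [/\ H 1, forall x y, H x -> H y -> H (x * y) & forall x, H x -> H x^-1].

Definition generated (G : groupType) (A : set G) : set G :=
  smallest (@is_subgroup G) A.

Definition locally_finite (G : groupType) : Prop :=
  forall s : seq G, finite_set (generated [set` s]).

Definition has_order (G : groupType) (x : G) (k : nat) : Prop :=
  [/\ (0 < k)%N, x ^+ k = 1 & forall j, (0 < j < k)%N -> x ^+ j <> 1].

Definition centralizer (G : groupType) (x : G) : set G :=
  [set y | commute x y].

Definition commutator_subgroup (G : groupType) (A B : set G) : set G :=
  generated [set z | exists x y, [/\ A x, B y & z = [~ x, y]]].

(* Indexing starts at 0: [lower_central H i] is the term usually written
   gamma_(i+1)(H). *)
Fixpoint lower_central (G : groupType) (H : set G) (i : nat) : set G :=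
  if i is j.+1 then commutator_subgroup (lower_central H j) H else H.

Definition nilpotent_of_class (G : groupType) (H : set G) (c : nat) : Prop :=
  lower_central H c = [set 1] /\
  forall i, (i < c)%N -> lower_central H i <> [set 1].

Fixpoint derived_series (G : groupType) (H : set G) (i : nat) : set G :=
  if i is j.+1
  then commutator_subgroup (derived_series H j) (derived_series H j)
  else H.

Definition soluble (G : groupType) (H : set G) : Prop :=
  exists d, derived_series H d = [set 1].

Definition has_derived_length (G : groupType) (H : set G) (d : nat) : Prop :=
  derived_series H d = [set 1] /\
  forall i, (i < d)%N -> derived_series H i <> [set 1].

Definition characteristic (G : groupType) (H : set G) : Prop :=
  forall f : G -> G, bijective f -> {morph f : x y / x * y} -> f @` H = H.

Definition left_cosets (G : groupType) (H : set G) : set (set G) :=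
  [set C | exists x, C = [set x * h | h in H]].

Definition has_index (G : groupType) (H : set G) (k : nat) : Prop :=
  (left_cosets H #= `I_k)%card.

(* Main.v *)
From HB Require Import structures.
From mathcomp Require Import boolp classical_sets functions cardinality.
From mathcomp Require Import all_boot fingroup action.
Require Import Defs.

(**
The element g lies in N = C(t), where t = g^(2^(n-1)) is the involution, and
N is nilpotent of class c. A nilpotent group with an element whose centralizer
has order at most m is itself bounded: going down the lower central series of
N, the map x |-> [x, g] sends each term to the next one and its fibres are
translates of subsets of C(g), so |N| <= m^c =: M (lemma [at_most_nilpotent]).
Hence the corollary is about an involution t with |C(t)| <= M, and the derived
length will be at most 2.

In a finite group E containing t, the pairs of conjugates (t^x, t^y) with a
given product u number at most |C_E(u)|, because both conjugates invert u;
counting all pairs gives |E|^2 <= M^2 * sum_u |C_E(u)|. So two random elements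
commute with probability at least 1/M^2, and with k = 2 M^2 at least |E|/k
elements of E have at most k conjugates. Therefore among any k + 1 elements
r_i two have a quotient r_i^-1 r_j with at most k^2 conjugates
([few_conjugates_pair]). Local finiteness carries this statement to G
([few_conjugates_difference]): a failure in G is witnessed by finitely many
elements.

Let X_a be the set of elements of G with at most a conjugates, so that
X_a X_b is contained in X_(ab). The pairs found above force one of the sets
X_b, with b bounded in terms of M, to be a subgroup H of index at most k
([few_conjugates_subgroup]). Conjugacy classes in H have bounded size, so H
has boundedly many commutators by an argument of Wiegold
([at_most_commutators]), and the centralizer V in H of all these commutators
has bounded index. Both H and V are defined without choices, hence
characteristic, and V has class at most 2 since [V, V] consists of products of
commutators of H, which V centralizes.
*)

Set Implicit Arguments.
Unset Strict Implicit.
Unset Printing Implicit Defensive.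

Local Open Scope group_scope.

(** * Finite groups: an involution with a small centralizer *)

(** Each u has at most |C(u)| factorisations u = a b with a, b conjugate to t:
both a and b are involutions, so a inverts u, and for a fixed factorisation
u = a0 b0 the product a0 a centralizes u and determines (a, b). *)
Lemma leq_sqr_sum_centralizers (gT : finGroupType) (G : {group gT}) (t : gT) :
  t \in G -> t ^+ 2 = 1 ->
  (#|G| ^ 2 <= #|'C_G[t]| ^ 2 * \sum_(u in G) #|'C_G[u]|)%N.
Proof.
move=> Gt t2.
have TG a : a \in t ^: G -> a \in G.
  by apply/subsetP; rewrite class_subG.
have invT a : a \in t ^: G -> a^-1 = a.
  case/imsetP=> x _ ->; rewrite -conjVg; congr (_ ^ x).
  by apply: (mulgI t); rewrite mulgV -t2 expgS expg1.
have -> : #|G| = (#|'C_G[t]| * #|t ^: G|)%N.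
  by rewrite -index_cent1 Lagrange // subsetIl.
rewrite expnMn leq_mul2l; apply/orP; right.
rewrite -mulnn -cardsX -sum1_card.
rewrite (partition_big (fun p : gT * gT => p.1 * p.2) [in G]) /=; last first.
  by move=> [a b] /setXP[/= /TG Ga /TG Gb]; rewrite groupM.
apply: leq_sum => u Gu.
rewrite sum1dep_card.
set P := [set p | _].
case: (set_0Vmem P) => [->|[[a0 b0]]]; first by rewrite cards0.
rewrite inE => /andP[/setXP[/= Ta0 Tb0] /eqP u0].
have injP : {in P &, injective (fun p : gT * gT => a0 * p.1)}.
  move=> [a b] [a' b']; rewrite !inE /= => /andP[_ /eqP ab] /andP[_ /eqP ab'].
  by move/mulgI => aa'; move: ab'; rewrite -ab aa' => /mulgI ->.
rewrite -(card_in_imset injP); apply: subset_leq_card.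
have invu a b : a \in t ^: G -> b \in t ^: G -> u = a * b -> u ^ a = u^-1.
  by move=> Ta Tb ->; rewrite conjgE -mulgA mulKg invMg (invT a) // (invT b).
apply/subsetP=> _ /imsetP[[a b] abP ->]; move: abP.
rewrite inE => /andP[/setXP[/= Ta Tb] /eqP ab].
apply/setIP; split; first by rewrite groupM ?TG.
apply/cent1P/esym/commgP/conjg_fixP.
rewrite conjgM (invu _ _ Ta0 Tb0) ?u0 // conjVg (invu _ _ Ta Tb) ?ab //.
by rewrite invgK.
Qed.

(** The elements with more than k conjugates have centralizers of order less
than |G|/k, so they account for at most |G|^2/k of the sum, which is half of
what is assumed; the other half must come from the elements counted here. *)
Lemma leq_mul_many_centralizers (gT : finGroupType) (G : {group gT}) (k : nat) :
  (#|G| ^ 2 * 2 <= k * \sum_(u in G) #|'C_G[u]|)%N ->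
  (#|G| <= k * #|[set u in G | (#|u ^: G| <= k)%N]|)%N.
Proof.
set L := [set u in G | _] => dense.
have kC u : u \in G -> u \notin L -> (k * #|'C_G[u]| <= #|G|)%N.
  move=> Gu; rewrite inE Gu /= -ltnNge => /ltnW kclass.
  rewrite -[leqRHS](Lagrange (subsetIl G 'C[u])) index_cent1 mulnC.
  by rewrite leq_mul2l kclass orbT.
have sLG : L \subset G by apply/subsetP=> u; rewrite inE => /andP[].
have outside : (k * \sum_(u in G | u \notin L) #|'C_G[u]| <= #|G| ^ 2)%N.
  rewrite big_distrr /= -mulnn -[X in (_ <= X * _)%N]sum1_card big_distrl /=.
  rewrite [leqRHS](bigID [in L]) /=; apply: leq_trans (leq_addl _ _).
  by apply: leq_sum => u /andP[Gu Lu]; rewrite mul1n kC.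
have inside : (\sum_(u in G | u \in L) #|'C_G[u]| <= #|L| * #|G|)%N.
  rewrite -[X in (_ <= X * _)%N]sum1_card big_distrl /=.
  rewrite (eq_bigl [in L]) => [|u]; last first.
    by rewrite andb_idl // => /(subsetP sLG).
  by apply: leq_sum => u _; rewrite mul1n subset_leq_card ?subsetIl.
move: dense; rewrite (bigID [in L]) /= mulnDr muln2 -addnn => dense.
have: (#|G| ^ 2 <= k * (#|L| * #|G|))%N.
  rewrite -(leq_add2r (#|G| ^ 2)); apply: leq_trans dense _.
  by rewrite leq_add // leq_mul2l inside orbT.
by rewrite -mulnn mulnA leq_pmul2r // cardG_gt0.
Qed.

(** The set L of elements with at most k conjugates has at least |G|/k elements,
so the k + 1 translates r_i L cannot be disjoint, and r_i u = r_j v gives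
r_i^-1 r_j = u v^-1 with u and v in L. *)
Lemma few_conjugates_pair (gT : finGroupType) (G : {group gT}) (t : gT)
    (M : nat) (k := (2 * M ^ 2)%N) (r : 'I_k.+1 -> gT) :
  t \in G -> t ^+ 2 = 1 -> (#|'C_G[t]| <= M)%N -> (forall i, r i \in G) ->
  exists i j, i != j /\ (#|((r i)^-1 * r j) ^: G| <= k * k)%N.
Proof.
move=> Gt t2 CM Gr; set L := [set u in G | (#|u ^: G| <= k)%N].
have dense : (#|G| <= k * #|L|)%N.
  apply: leq_mul_many_centralizers; rewrite mulnC /k -mulnA leq_mul2l /=.
  apply: leq_trans (leq_sqr_sum_centralizers Gt t2) _.
  by rewrite leq_mul2r leq_exp2r // CM orbT.
pose f (p : 'I_k.+1 * gT) := r p.1 * p.2.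
have [/dinjectiveP injf|] := boolP (dinjectiveb f (setX setT L)).
  have : (#|setX [set: 'I_k.+1] L| <= #|G|)%N.
    rewrite -(card_in_imset injf); apply: subset_leq_card.
    apply/subsetP=> _ /imsetP[[i u] /setXP[_ Lu] ->].
    by move: Lu; rewrite inE => /andP[Gu _]; rewrite groupM.
  rewrite cardsX cardsT card_ord => /leq_trans/(_ dense).
  rewrite mulSn -[leqRHS]add0n leq_add2r leqn0 => /eqP L0.
  by move: dense; rewrite L0 muln0 leqNgt cardG_gt0.
case/dinjectivePn=> [[i u] /setXP[/= _ Lu]] [[j v]].
rewrite inE /= => /andP[neq /setXP[/= _ Lv]] ruv.
have ij : i != j.
  apply: contraNneq neq => eij; move: ruv; rewrite /f /= eij => /mulgI->.
  exact: eqxx.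
exists i, j; split=> //; move: Lu Lv; rewrite !inE.
move=> /andP[Gu uk] /andP[Gv vk].
have -> : (r i)^-1 * r j = u * v^-1.
  by apply: (mulIg v); rewrite mulgKV -mulgA -[r j * v]ruv mulKg.
apply: (@leq_trans #|setX (u ^: G) (v^-1 ^: G)|); last first.
  by rewrite cardsX leq_mul // classVg card_invg.
apply: leq_trans (leq_imset_card (fun p => p.1 * p.2) _).
apply: subset_leq_card; apply/subsetP=> _ /imsetP[x Gx ->].
by apply/imsetP; exists (u ^ x, v^-1 ^ x); rewrite ?inE ?memJ_class ?conjMg.
Qed.

(* From here on, sets are classical subsets of arbitrary types, so their
lemmas and notations take precedence over those of finite sets. *)

Import classical_sets functions cardinality.
Local Open Scope classical_set_scope.

(** * Sets with boundedly many elements *)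

(** Bounding by a list instead of a cardinal keeps every bound explicit: images,
products and unions of lists are lists of computable size. *)
Definition at_most (T : eqType) (a : nat) (A : set T) :=
  exists2 s : seq T, (size s <= a)%N & A `<=` [set` s].

Lemma at_most_sub (T : eqType) a (A B : set T) :
  A `<=` B -> at_most a B -> at_most a A.
Proof. by move=> AB [s sa Bs]; exists s => // x /AB /Bs. Qed.

Lemma at_most_leq (T : eqType) a b (A : set T) :
  (a <= b)%N -> at_most a A -> at_most b A.
Proof. by move=> ab [s sa As]; exists s => //; apply: leq_trans ab. Qed.

Lemma at_most_gt0 (T : eqType) a (A : set T) x :
  A x -> at_most a A -> (0 < a)%N.
Proof.
by move=> Ax [[|y s] sa /(_ _ Ax)] //= _; apply: leq_ltn_trans sa.
Qed.

(** The witnesses of many values are arguments of f and not values: they are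
the elements that are later put into a finitely generated subgroup. *)
Lemma at_most_or_more (T U : eqType) (f : T -> U) (A : set T) a :
  at_most a (f @` A) \/
  exists ys, [/\ size ys = a.+1, [set` ys] `<=` A & uniq (map f ys)].
Proof.
elim: a => [|a [[s sa As]|[ys [sz Ays uys]]]].
- have [[x Ax]|A0] := pselect (exists x, A x).
    by right; exists [:: x]; split=> // y; rewrite /= inE => /eqP->.
  by left; exists [::] => // z [x Ax _]; case: A0; exists x.
- by left; exists s => //; apply: leqW.
- have [As|/existsNP[x /not_implyP[Ax xs]]] :=
      pselect (forall x, A x -> f x \in map f ys).
    by left; exists (map f ys); rewrite ?size_map ?sz // => _ [x /As xs <-].
  right; exists (x :: ys); split=> /=; first by rewrite sz.
    by move=> y; rewrite /= inE => /orP[/eqP->//|/Ays].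
  by rewrite uys andbT; apply/negP.
Qed.

Lemma at_most_representatives (T U : eqType) (f : T -> U) (A : set T) a :
  at_most a (f @` A) ->
  exists R : seq T, [/\ (size R <= a)%N, [set` R] `<=` A &
    forall x, A x -> exists2 r, r \in R & f r = f x].
Proof.
case=> s sa As; elim: s a A sa As => [|u s IH] a A sa As.
  by exists [::]; split=> // x Ax; have := As _ (imageP f Ax).
have sa' : (size s <= a.-1)%N by case: a sa.
have As' : f @` (A `&` [set x | f x != u]) `<=` [set` s].
  move=> _ [x [Ax xu] <-]; have := As _ (imageP f Ax).
  by rewrite /= inE (negPf xu).
have [R [Ra RA Rx]] := IH _ _ sa' As'.
have [[y Ay fy]|nou] := pselect (exists2 y, A y & f y = u).
  exists (y :: R); split.
  - by case: a sa Ra {IH sa'}.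
  - by move=> z /=; rewrite inE => /orP[/eqP->//|/RA[]].
  - move=> x Ax; have [fx|fx] := eqVneq (f x) u.
      by exists y; rewrite ?mem_head // fy.
    by have [//|r rR fr] := Rx x; exists r; rewrite // inE rR orbT.
exists R; split; first exact: leq_trans Ra (leq_pred _).
  by move=> z /RA[].
move=> x Ax; apply: Rx; split=> //; apply/eqP => fx; apply: nou.
by exists x.
Qed.

Lemma at_most_bigcup (I T : eqType) (R : seq I) (F : I -> set T) a b :
  (size R <= a)%N -> (forall i, i \in R -> at_most b (F i)) ->
  at_most (a * b) (\bigcup_(i in [set` R]) F i).
Proof.
move=> Ra Fb; apply: at_most_leq (leq_mul Ra (leqnn b)) _.
elim: R {Ra} Fb => [|i R IH] Fb; first by exists [::] => // x [].
have [s sb Fs] := Fb i (mem_head _ _).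
have [|s' sb' Fs'] := IH; first by move=> j jR; apply: Fb; rewrite inE jR orbT.
exists (s ++ s'); first by rewrite size_cat mulSn leq_add.
move=> x [j /= + Fjx]; rewrite mem_cat inE => /orP[/eqP eji|jR].
  by rewrite Fs // -eji.
by apply/orP; right; apply: Fs'; exists j.
Qed.

Lemma at_most_fibers (T U : eqType) (f : T -> U) (A : set T) a b :
  at_most a (f @` A) ->
  (forall x, A x -> at_most b [set y | A y /\ f y = f x]) ->
  at_most (a * b) A.
Proof.
case/at_most_representatives=> R [Ra RA Rx] fib.
have := at_most_bigcup Ra (fun r rR => fib r (RA r rR)).
by apply: at_most_sub => x Ax; have [r rR fr] := Rx x Ax; exists r.
Qed.

Lemma at_most_image2 (T1 T2 U : eqType) (f : T1 -> T2 -> U) a b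
    (A : set T1) (B : set T2) :
  at_most a A -> at_most b B -> at_most (a * b) [set f x y | x in A & y in B].
Proof.
case=> s sa As [s' sb Bs]; exists [seq f x y | x <- s, y <- s'].
  by rewrite size_allpairs leq_mul.
by move=> _ [x /As xs [y /Bs ys] <-]; apply/allpairsP; exists (x, y).
Qed.

Lemma at_most_image (T U : eqType) (f : T -> U) a (A : set T) :
  at_most a A -> at_most a (f @` A).
Proof.
case=> s sa As; exists (map f s); first by rewrite size_map.
by move=> _ [x /As xs <-]; apply: map_f.
Qed.

Lemma at_most_map_seq (I T U : eqType) (f : I -> T -> U) (A : set T) a
    (s : seq I) :
  (forall i, i \in s -> at_most a (f i @` A)) ->
  at_most (a ^ size s) ((fun x => [seq f i x | i <- s]) @` A).
Proof.
elim: s => [|i s IH] fA /=.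
  by exists [:: [::]] => // _ [x _ <-] /=; rewrite inE.
rewrite expnS; apply: at_most_sub (at_most_image2 cons (fA i _) (IH _)).
- move=> _ [x Ax <-]; exists (f i x); first by exists x.
  by exists [seq f i x | i <- s] => //; exists x.
- exact: mem_head.
- by move=> j js; apply: fA; rewrite inE js orbT.
Qed.

Lemma at_most_card_eq (T : eqType) (A : set T) m :
  (A #= `I_m)%card -> at_most m A.
Proof.
elim: m A => [|m IH] A; first by rewrite II0 card_eq0 => /eqP->; exists [::].
case/eq_cardSP=> x Ax /IH[s sm As]; exists (x :: s) => // y Ay /=.
rewrite inE; have [//|yx] := eqVneq y x.
by apply: As; split=> //; apply/eqP.
Qed.

(** * Conjugacy classes of bounded size *)

Section Conjugates.
Variable G : groupType.
Implicit Types (H : set G) (x y : G).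

Definition conjugates H x : set G := (fun y => x ^ y) @` H.

Lemma at_most_conjugatesM H a b x y :
  at_most a (conjugates H x) -> at_most b (conjugates H y) ->
  at_most (a * b) (conjugates H (x * y)).
Proof.
move=> xa yb; apply: at_most_sub (at_most_image2 (fun u v => u * v) xa yb).
move=> _ [z Hz <-]; rewrite conjMg; exists (x ^ z); first by exists z.
by exists (y ^ z) => //; exists z.
Qed.

Lemma at_most_conjugatesV H a x :
  at_most a (conjugates H x) -> at_most a (conjugates H x^-1).
Proof.
move=> xa; apply: at_most_sub (at_most_image (fun u => u^-1) xa).
by move=> _ [z Hz <-]; exists (x ^ z); rewrite ?conjVg //; exists z.
Qed.

End Conjugates.

Definition few_conjugates (G : groupType) a : set G :=
  [set x | at_most a (conjugates setT x)].

(** R may be redundant: its size only bounds the index of H. *)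
Definition covers (G : groupType) (H : set G) (R : seq G) :=
  forall x, exists2 r, r \in R & H (r^-1 * x).

(** * From finite subgroups to a locally finite group *)

Section FiniteSubgroup.
Variables (G : groupType) (e : seq G) (He : is_subgroup [set` e]).

(** The closure proof is a parameter of the type so that the group structure
built from it can be inferred. *)
Definition seq_group of is_subgroup [set` e] : Type := seq_sub e.
Local Notation E := (seq_group He).

HB.instance Definition _ := Finite.copy E (seq_sub e).

Fact seq_group_one_subproof : 1 \in e. Proof. by case: He. Qed.
Fact seq_group_mul_subproof (x y : E) : ssval x * ssval y \in e.
Proof. by case: He => _ + _; apply; apply: ssvalP. Qed.
Fact seq_group_inv_subproof (x : E) : (ssval x)^-1 \in e.
Proof. by case: He => _ _; apply; apply: ssvalP. Qed.

Let one : E := SeqSub seq_group_one_subproof.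
Let mul (x y : E) : E := SeqSub (seq_group_mul_subproof x y).
Let inv (x : E) : E := SeqSub (seq_group_inv_subproof x).

Fact seq_group_mulA : associative mul.
Proof. by move=> x y z; apply: val_inj; apply: mulgA. Qed.
Fact seq_group_mul1 : left_id one mul.
Proof. by move=> x; apply: val_inj; apply: mul1g. Qed.
Fact seq_group_mulV : left_inverse one inv mul.
Proof. by move=> x; apply: val_inj; apply: mulVg. Qed.

HB.instance Definition _ :=
  Finite_isGroup.Build E seq_group_mulA seq_group_mul1 seq_group_mulV.

End FiniteSubgroup.

Lemma generated_subgroup (G : groupType) (A : set G) :
  is_subgroup (generated A).
Proof.
split=> [|x y Hx Hy|x Hx] H [sH AH]; case: (sH) => H1 HM HV //.
  by apply: HM; [apply: Hx|apply: Hy].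
by apply: HV; apply: Hx.
Qed.

(** If the conclusion fails, then for every pair (i, j) there are k^2 + 1
elements that conjugate r_i^-1 r_j to different elements. These finitely many
conjugators, the r_i and t generate a finite group, where
[few_conjugates_pair] gives a contradiction. *)
Lemma few_conjugates_difference (G : groupType) (t : G) (M : nat)
    (k := (2 * M ^ 2)%N) (r : 'I_k.+1 -> G) :
  locally_finite G -> t ^+ 2 = 1 -> at_most M (centralizer t) ->
  exists i j, i != j /\ few_conjugates (k * k) ((r i)^-1 * r j).
Proof.
move=> lfG t2 [cs csM Ccs].
apply/notP => none.
have /choice[ys ysP] : forall p : 'I_k.+1 * 'I_k.+1, exists ys : seq G,
    p.1 != p.2 -> size ys = (k * k).+1 /\
                  uniq (map (fun y => ((r p.1)^-1 * r p.2) ^ y) ys).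
  move=> [i j] /=; have [ij|] := boolP (i != j); last by exists [::].
  have [few|[ys [sys _ uys]]] :=
    at_most_or_more (fun y => ((r i)^-1 * r j) ^ y) setT (k * k).
    by case: none; exists i, j.
  by exists ys.
pose gens := t :: codom r ++ flatten (codom ys).
have /finite_seqP[e eE] := lfG gens.
have He : is_subgroup [set` e] by rewrite -eE; apply: generated_subgroup.
have gens_e x : x \in gens -> x \in e.
  move=> gx; have : generated [set` gens] x by apply: sub_gen_smallest.
  by rewrite eE.
pose E := seq_group He.
pose v : E -> G := @ssval G e.
have te : t \in e by apply: gens_e; rewrite mem_head.
have re i : r i \in e by apply: gens_e; rewrite inE mem_cat codom_f orbT.
have ye p y : y \in ys p -> y \in e.
  move=> yp; apply: gens_e; rewrite inE mem_cat; apply/orP; right.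
  by apply/orP; right; apply/flattenP; exists (ys p); rewrite ?codom_f.
pose tE : E := SeqSub te.
pose rE i : E := SeqSub (re i).
have tE2 : tE ^+ 2 = 1 by apply: val_inj.
have CM : (#|'C_([set: E]%G)[tE]| <= M)%N.
  apply: leq_trans csM; rewrite cardE -(size_map v).
  apply: uniq_leq_size => [|_ /mapP[x xC ->]].
    by rewrite map_inj_uniq ?enum_uniq //; apply: val_inj.
  move: xC; rewrite mem_enum => /setIP[_ /cent1P tx]; apply: Ccs.
  by have /(congr1 v) := tx.
have allE x : x \in [set: E]%G by apply: finset.in_setT.
have [i [j [ij Eij]]] := @few_conjugates_pair _ _ _ _ rE (allE tE) tE2 CM
  (fun i => allE (rE i)).
have [sys uys] := ysP (i, j) ij.
move: Eij; rewrite leqNgt => /negP; apply.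
pose yE : seq E := pmap insub (ys (i, j)).
have yEK : map v yE = ys (i, j).
  rewrite pmap_filter; last exact: insubK.
  by apply/all_filterP/allP => y /ye ey; rewrite isSome_insub.
rewrite -/k -sys -yEK size_map -(size_map (fun y => (((rE i)^-1 * rE j) ^ y))).
rewrite cardE; apply: uniq_leq_size => [|_ /mapP[y _ ->]].
  move: uys; rewrite -yEK -map_comp => uys.
  by apply: (@map_uniq _ _ v); rewrite -map_comp.
by rewrite mem_enum; apply: imset_f; apply: allE.
Qed.

(** * A characteristic subgroup with bounded conjugacy classes *)

(** Write X_a for [few_conjugates a]. By induction on k it suffices to treat the
case that some r_0, ..., r_k are pairwise incongruent even modulo X_(a^4). Then
by hypothesis every x is congruent to some r_i modulo X_a. For x, y in X_a let
r_0 x y be congruent to r_i: then r_i^-1 r_0 is a product of three elements of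
X_a, so i = 0 and x y lies in X_a, which is therefore a subgroup. *)
Lemma few_conjugates_subgroup (G : groupType) (k a : nat) :
  (forall r : 'I_k.+1 -> G,
     exists i j, i != j /\ few_conjugates a ((r i)^-1 * r j)) ->
  exists b (R : seq G),
    [/\ (b <= a ^ (4 ^ k))%N, is_subgroup (@few_conjugates G b),
        (size R <= k)%N & covers (few_conjugates b) R].
Proof.
elim: k a => [|k IH] a close.
  by have [i [j [ij _]]] := close (fun=> 1); rewrite (ord1 i) (ord1 j) in ij.
have [/IH[b [R [ba sgb Rk cov]]]|/existsNP[r far]] :=
    pselect (forall r : 'I_k.+1 -> G,
      exists i j, i != j /\ few_conjugates (a ^ 4) ((r i)^-1 * r j)).
  exists b, R; split=> //; last exact: leqW.
  by rewrite expnS expnM.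
have aa4 (x : G) : few_conjugates a x -> few_conjugates (a ^ 4) x.
  apply: at_most_leq; rewrite -{1}(expn1 a).
  by case: (a) => // a'; rewrite leq_pexp2l.
have cov x : exists i, few_conjugates a ((r i)^-1 * x).
  have [i [j []]] :=
    close (fun i => if unlift ord0 i is Some i' then r i' else x).
  case: unliftP => [i'|] ->; case: unliftP => [j'|] -> //= ij aij.
  - case: far; exists i', j'; split; last exact: aa4.
    by apply: contraNneq ij => ->.
  - by exists i'.
  - exists j'; have -> : (r j')^-1 * x = (x^-1 * r j')^-1.
      by rewrite invMg invgK.
    exact: at_most_conjugatesV.
have a_gt0 : (0 < a)%N.
  by have [i] := cov 1; apply: at_most_gt0; exists 1.
have aV (x : G) : few_conjugates a x -> few_conjugates a x^-1.
  by move=> ax; apply: at_most_conjugatesV.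
exists a, (codom r); split.
- by rewrite -{1}(expn1 a) leq_pexp2l // expn_gt0.
- split=> [|x y ax ay|]; last exact: aV.
    exists [:: 1] => // _ [y _ <-].
    by rewrite conj1g /= mem_head.
  have [i az] := cov (r ord0 * (x * y)).
  have -> : x * y = (r ord0)^-1 * (r ord0 * (x * y)) by rewrite mulKg.
  have [i0|i0] := eqVneq i ord0; first by rewrite -{1}i0.
  case: far; exists i, ord0; split=> //.
  have -> : (r i)^-1 * r ord0 = ((r i)^-1 * (r ord0 * (x * y))) * (y^-1 * x^-1).
    by rewrite -invMg mulgA mulgK.
  have := at_most_conjugatesM az (at_most_conjugatesM (aV _ ay) (aV _ ax)).
  apply: at_most_leq; by rewrite mulnn -expnS leq_pexp2l.
- by rewrite size_codom card_ord.
- by move=> x; have [i ai] := cov x; exists (r i); rewrite ?codom_f.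
Qed.

(** * Boundedly many commutators *)

(** Two elements that conjugate every entry of s in the same way differ by an
element that centralizes s. *)
Lemma centralizer_representatives (G : groupType) (H : set G) (n : nat)
    (s : seq G) :
  (forall b, b \in s -> at_most n (conjugates H b)) ->
  exists R : seq G, [/\ (size R <= n ^ size s)%N, [set` R] `<=` H &
    forall h, H h -> exists2 r, r \in R &
      forall b, b \in s -> commute (h * r^-1) b].
Proof.
move=> /(@at_most_map_seq _ _ _ (fun b h : G => b ^ h)).
case/at_most_representatives=> R [Rn RH Rh].
exists R; split=> // h /Rh[r rR /eq_in_map rh]; exists r => // b /rh eb.
apply/esym/commgP/conjg_fixP.
by rewrite conjgM -eb -conjgM mulgV conjg1.
Qed.

Lemma largest_conjugacy_class (G : groupType) (H : set G) (n : nat) :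
  is_subgroup H -> (forall x, H x -> at_most n (conjugates H x)) ->
  exists x s, [/\ (size s <= n)%N, H x, [set` s] `<=` H,
    forall y, H y -> at_most (size s) (conjugates H y) &
    uniq [seq x ^ b | b <- s]].
Proof.
case=> H1 _ _; elim: n => [|n IH] Hn.
  suff: (0 < 0)%N by [].
  by apply: at_most_gt0 (Hn 1 H1); exists 1.
have [/IH[x [s [sn Hx sH Hs us]]]|] :=
    pselect (forall x, H x -> at_most n (conjugates H x)).
  by exists x, s; split=> //; apply: leqW.
case/existsNP=> x /not_implyP[Hx nx].
have [//|[s [ss sH us]]] := at_most_or_more (fun b => x ^ b) H n.
by exists x, s; split; rewrite ?ss.
Qed.

Lemma commg_mulJ (G : groupType) (x y z : G) :
  [~ x * y, z] = [~ x, z] ^ y * [~ y, z].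
Proof.
rewrite !commgEl conjMg invMg [_ ^ y in RHS]conjgE -!mulgA.
by rewrite (mulKVg y).
Qed.

Definition commutators (G : groupType) (H : set G) : set G :=
  [set [~ x, y] | x in H & y in H].

(** Wiegold's argument. Choose x with a conjugacy class of the largest size and
conjugators s that list it, and let u centralize s. The conjugates of u x by
the entries of s are the elements u x^b; they are distinct, so they exhaust the
class of u x. Hence for each h there is b with (u x)^h = u x^b, that is,
[u, h] = x^b (x^h)^-1, and x^h is one of the x^c. So such u have only
|s|^2 commutators with elements of H. Every element of H is u r for such a u
and one of boundedly many r, and [u r, h] = [u, h]^r r^-1 r^h. *)
Lemma at_most_commutators (G : groupType) (H : set G) (n : nat) :
  is_subgroup H -> (forall x, H x -> at_most n (conjugates H x)) ->
  at_most (n ^ (n + 3)) (commutators H).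
Proof.
move=> sgH Hn; have [H1 HM HV] := sgH.
have [x [s [sn Hx sH Hs us]]] := largest_conjugacy_class sgH Hn.
have [R [Rs RH Rh]] := centralizer_representatives (fun b bs => Hn b (sH b bs)).
have n_gt0 : (0 < n)%N by apply: at_most_gt0 (Hn 1 H1); exists 1.
pose S := [set (x ^ b) * (x ^ c)^-1 | b in [set` s] & c in [set` s]].
have class_ux u : H u -> (forall b, b \in s -> commute u b) ->
    forall h, H h -> exists2 b, b \in s & (u * x) ^ h = u * x ^ b.
  move=> Hu us' h Hh; have [cl cls Hcl] := Hs _ (HM _ _ Hu Hx).
  have conj_u b : b \in s -> (u * x) ^ b = u * x ^ b.
    by move=> /us' ub; rewrite conjMg; congr (_ * _); apply/conjg_fixP/commgP.
  have sub : {subset [seq u * x ^ b | b <- s] <= cl}.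
    move=> _ /mapP[b bs ->]; apply: Hcl; rewrite -conj_u //.
    by exists b => //; apply: sH.
  have uniq_ux : uniq [seq u * x ^ b | b <- s].
    by rewrite (map_comp (mulg u)) map_inj_uniq //; apply: mulgI.
  have le_cl : (size cl <= size [seq (u * x ^ b)%g | b <- s])%N.
    by rewrite size_map.
  have [_ eq_cl] := uniq_min_size uniq_ux sub le_cl.
  have : (u * x) ^ h \in cl by apply: Hcl; exists h.
  rewrite -eq_cl => /mapP[b bs ->].
  by exists b.
have comm_u u h :
    H u -> (forall b, b \in s -> commute u b) -> H h -> S [~ u, h].
  move=> Hu us' Hh.
  have [b bs ub] := class_ux u Hu us' h Hh.
  have [c cs uc] := class_ux 1 H1 (fun b _ => commute_sym (commute1 b)) h Hh.
  exists b => //; exists c => //.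
  rewrite !mul1g in uc; rewrite -uc commgEl.
  apply: (mulgI u); rewrite mulKVg mulgA -ub conjMg mulgK.
  by [].
have Sn : at_most (n * n) S.
  by apply: at_most_image2; exists s.
have RSn : at_most (n ^ n * (n * n * n))
    (\bigcup_(r in [set` R])
       [set w ^ r * (r^-1 * z) | w in S & z in conjugates H r]).
  apply: at_most_bigcup => [|r rR].
    by apply: leq_trans Rs _; rewrite leq_pexp2l.
  apply: (at_most_image2 (fun w z => w ^ r * (r^-1 * z)) Sn).
  exact: Hn (RH _ rR).
apply: at_most_sub (at_most_leq _ RSn); last first.
  by rewrite expnD !expnSr expn0 mul1n.
move=> _ [y Hy [h Hh <-]]; have [r rR ur] := Rh y Hy; exists r => //.
have Hr := RH _ rR; have Hu : H (y * r^-1) by apply: HM => //; apply: HV.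
exists [~ y * r^-1, h]; first exact: comm_u.
exists (r ^ h); first by exists h.
by rewrite -commgEl -commg_mulJ mulgVK.
Qed.

(** * Nilpotent groups with a small centralizer *)

(** If [y, g] = [x, g], then x y^-1 centralizes g; so the order grows by a
factor of at most m with each step up the lower central series. *)
Lemma at_most_nilpotent (G : groupType) (N : set G) (g : G) (m c : nat) :
  lower_central N c = [set 1] -> N g -> at_most m (centralizer g) ->
  at_most (m ^ c) N.
Proof.
move=> Nc Ng Cm.
suff lc j i : (i + j)%N = c -> at_most (m ^ j) (lower_central N i).
  exact: (lc c 0).
elim: j i => [|j IH] i ijc.
  by exists [:: 1] => // x; rewrite -(addn0 i) ijc Nc /= inE => ->.
rewrite expnSr; apply: (at_most_fibers (f := fun x => [~ x, g])).
  apply: at_most_sub (IH i.+1 _); last by rewrite addSnnS.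
  by move=> _ [x Nx <-]; apply: sub_gen_smallest; exists x, g.
move=> x _; apply: at_most_sub (at_most_image (fun w => w^-1 * x) Cm).
move=> y [_]; rewrite !commgEl => yx; exists (x * y^-1); last first.
  by rewrite invMg invgK mulgKV.
apply/esym/commgP/conjg_fixP; rewrite conjMg conjVg.
apply: (mulgI x^-1); rewrite mulgA -yx mulgK mulKg.
by [].
Qed.

(** * The centralizer of all commutators *)

Lemma has_index_covers (G : groupType) (V : set G) (R : seq G) (K : nat) :
  is_subgroup V -> covers V R -> (size R <= K)%N ->
  exists2 k, has_index V k & (k <= K)%N.
Proof.
move=> [V1 VM VV] cov RK; pose coset (x : G) : set G := [set x * h | h in V].
have sub : left_cosets V `<=` (fun i => coset (nth 1 R i)) @` `I_(size R).
  move=> _ [x ->]; have [r rR Vrx] := cov x.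
  exists (index r R); first by rewrite /= index_mem.
  rewrite nth_index //; apply/seteqP; split=> _ [h Vh <-].
    exists ((r^-1 * x)^-1 * h); first by apply: VM => //; apply: VV.
    by rewrite invMg invgK -mulgA mulKVg.
  exists (r^-1 * x * h); first exact: VM.
  by rewrite -mulgA mulKVg.
have le : (left_cosets V #<= `I_(size R))%card.
  exact: card_le_trans (subset_card_le sub) (card_image_le _ _).
have /finite_setP[k Vk] : finite_set (left_cosets V).
  by apply/finite_set_leP; exists (size R).
exists k => //; apply: leq_trans RK; rewrite -card_le_II.
by apply: card_le_trans le; move: Vk; rewrite card_eq_le => /andP[].
Qed.

Lemma characteristic_stable (G : groupType) (A : set G) :
  (forall f : G -> G, bijective f -> {morph f : x y / x * y} ->
     forall x, A x -> A (f x)) -> characteristic A.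
Proof.
move=> stab f bij_f fM; have [f' fK f'K] := bij_f.
apply/seteqP; split=> [_ [x Ax <-]|x Ax]; first exact: stab.
exists (f' x) => //; apply: stab => //; first by exists f.
by move=> y z; rewrite -{1}(f'K y) -{1}(f'K z) -fM fK.
Qed.

Lemma morph_groupV (G : groupType) (f : G -> G) :
  {morph f : x y / x * y} -> {morph f : x / x^-1}.
Proof.
move=> fM x; apply: (mulgI (f x)); rewrite -fM !mulgV.
by apply: (mulgI (f 1)); rewrite -fM !mulg1.
Qed.

Lemma few_conjugates_morph (G : groupType) (a : nat) (f : G -> G) (x : G) :
  bijective f -> {morph f : x y / x * y} ->
  few_conjugates a x -> few_conjugates a (f x).
Proof.
move=> [f' _ f'K] fM /(at_most_image f); apply: at_most_sub => _ [y _ <-].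
exists (x ^ f' y); first by exists (f' y).
by rewrite !conjgE !fM (morph_groupV fM) f'K.
Qed.

Lemma subgroup_commg (G : groupType) (H : set G) (x y : G) :
  is_subgroup H -> H x -> H y -> H [~ x, y].
Proof.
move=> [_ HM HV] Hx Hy; rewrite commgEl conjgE.
exact: (HM _ _ (HV _ Hx) (HM _ _ (HV _ Hy) (HM _ _ Hx Hy))).
Qed.

Definition commutator_centralizer (G : groupType) (H : set G) : set G :=
  H `&` [set v | forall w, commutators H w -> commute v w].

Lemma commutator_centralizer_subgroup (G : groupType) (H : set G) :
  is_subgroup H -> is_subgroup (commutator_centralizer H).
Proof.
move=> [H1 HM HV]; split=> [|x y [Hx Cx] [Hy Cy]|x [Hx Cx]].
- by split=> // w _; apply: commute_sym; apply: commute1.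
- split=> [|w Hw]; first exact: HM.
  by apply/commute_sym/commuteM; apply: commute_sym; [apply: Cx|apply: Cy].
- split=> [|w Hw]; first exact: HV.
  by apply/commute_sym/commuteV/commute_sym/Cx.
Qed.

Lemma commutator_centralizer_characteristic (G : groupType) (H : set G) :
  (forall f : G -> G, bijective f -> {morph f : x y / x * y} ->
     forall x, H x -> H (f x)) ->
  characteristic (commutator_centralizer H).
Proof.
move=> stab; apply: characteristic_stable => f bij_f fM v [Hv Cv].
split=> [|_ [x Hx [y Hy <-]]]; first exact: stab.
have [f' fK f'K] := bij_f.
have H' z : H z -> H (f' z).
  apply: stab; first by exists f.
  by move=> x1 x2; rewrite -{1}(f'K x1) -{1}(f'K x2) -fM fK.
have : commute v [~ f' x, f' y].
  by apply: Cv; exists (f' x); [|exists (f' y)]; try apply: H'.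
move/(congr1 f) => e.
have <- : f [~ f' x, f' y] = [~ x, y]; last by rewrite /commute -!fM e.
by rewrite !commgEl !conjgE !fM !(morph_groupV fM) !f'K.
Qed.

(** Write V for [commutator_centralizer H]. Commutators of elements of V are
commutators of elements of H, so they lie in the centre of V. *)
Lemma derived_commutator_centralizer (G : groupType) (H : set G) :
  is_subgroup H -> derived_series (commutator_centralizer H) 2 = [set 1].
Proof.
move=> sgH; set V := commutator_centralizer H.
have sgV : is_subgroup V := commutator_centralizer_subgroup sgH.
have [V1 VM VV] := sgV.
pose Z := V `&` [set z | forall v, V v -> commute v z].
have sgZ : is_subgroup Z.
  split=> [|x y [Vx Cx] [Vy Cy]|x [Vx Cx]].
  - by split=> // v _; apply: commute1.
  - by split=> [|v Vv]; [apply: VM|apply: commuteM; [apply: Cx|apply: Cy]].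
  - by split=> [|v Vv]; [apply: VV|apply/commuteV/Cx].
have V'Z : derived_series V 1 `<=` Z.
  apply: smallest_sub => //= _ [x [y [Vx Vy ->]]]; split.
    exact: subgroup_commg.
  by move=> v [_]; apply; exists x; [case: Vx|exists y => //; case: Vy].
apply/seteqP; split; last first.
  by move=> _ ->; case: (generated_subgroup [set z | exists x y,
    [/\ derived_series V 1 x, derived_series V 1 y & z = [~ x, y]]]).
apply: smallest_sub => [|_ [x [y [/V'Z [Vx _] /V'Z [_ Cy] ->]]]].
  by split=> [|x y -> ->|x ->] //=; rewrite ?mulg1 ?invg1.
by apply/eqP/commgP/Cy.
Qed.

Lemma has_derived_length_leq (G : groupType) (H : set G) (k : nat) :
  derived_series H k = [set 1] ->
  exists2 d, has_derived_length H d & (d <= k)%N.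
Proof.
move=> Hk; have ex : exists d, `[< derived_series H d = [set 1] >].
  by exists k; apply/asboolP.
have [d /asboolP Hd dmin] := ex_minnP ex.
exists d; last by apply: dmin; apply/asboolP.
split=> // i; apply: contraPnot => Hi.
by apply/negP; rewrite -leqNgt; apply: dmin; apply/asboolP.
Qed.

(** H has at most n^(n + 3) commutators, and the centralizer of each has index
at most n in H. *)
Lemma covers_commutator_centralizer (G : groupType) (H : set G) (n k : nat)
    (R : seq G) :
  is_subgroup H -> (forall x, H x -> at_most n (conjugates H x)) ->
  covers H R -> (size R <= k)%N ->
  exists R' : seq G, (size R' <= k * n ^ (n ^ (n + 3)))%N /\
    covers (commutator_centralizer H) R'.
Proof.
move=> sgH Hn cov Rk; have [H1 HM HV] := sgH.
have n_gt0 : (0 < n)%N by apply: at_most_gt0 (Hn 1 H1); exists 1.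
(* Passing to representatives discards entries that are not commutators. *)
have [W [Wn WH HW]] := at_most_representatives
  (at_most_image id (at_most_commutators sgH Hn)).
have WHn w : w \in W -> at_most n (conjugates H w).
  move=> /WH [x Hx [y Hy <-]]; apply: Hn.
  exact: subgroup_commg.
have [S [Sn SH HS]] := centralizer_representatives WHn.
exists [seq r * s^-1 | r <- R, s <- S]; split.
  rewrite size_allpairs leq_mul //; apply: leq_trans Sn _.
  by rewrite leq_pexp2l.
move=> x; have [r rR Hh] := cov x; have [s sS Cs] := HS _ (HV _ Hh).
exists (r * s^-1); first by apply/allpairsP; exists (r, s).
have Hs := SH _ sS.
have -> : (r * s^-1)^-1 * x = ((r^-1 * x)^-1 * s^-1)^-1.
  by rewrite !invMg !invgK mulgA.
split; first by apply: (HV); apply: HM; apply: HV.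
move=> w /HW[w' w'W /= <-].
by apply/commute_sym/commuteV/commute_sym/Cs.
Qed.

(** * The theorem *)

Definition cover_bound (M : nat) : nat := 2 * M ^ 2.
Definition class_bound (M : nat) : nat :=
  (cover_bound M * cover_bound M) ^ (4 ^ cover_bound M).
Definition index_bound (M : nat) : nat :=
  cover_bound M * class_bound M ^ (class_bound M ^ (class_bound M + 3)).

Theorem small_involution_centralizer (G : groupType) (t : G) (M : nat) :
  locally_finite G -> t ^+ 2 = 1 -> at_most M (centralizer t) ->
  exists V : set G,
    [/\ is_subgroup V, characteristic V, derived_series V 2 = [set 1] &
        exists2 k, has_index V k & (k <= index_bound M)%N].
Proof.
move=> lfG t2 CM.
have [b [R [bM sgH Rk cov]]] := few_conjugates_subgroup
  (fun r => few_conjugates_difference r lfG t2 CM).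
have Hn (x : G) : few_conjugates b x ->
    at_most (class_bound M) (conjugates (few_conjugates b) x).
  by move=> /(at_most_leq bM); apply: at_most_sub => _ [y _ <-]; exists y.
have [R' [R'k cov']] := covers_commutator_centralizer sgH Hn cov Rk.
exists (commutator_centralizer (few_conjugates b)); split.
- exact: commutator_centralizer_subgroup.
- apply: commutator_centralizer_characteristic => f bij_f fM x.
  exact: few_conjugates_morph.
- exact: derived_commutator_centralizer.
- by apply: has_index_covers cov' R'k; apply: commutator_centralizer_subgroup.
Qed.

Theorem corollary1p2 :
  exists (F : nat -> nat -> nat -> nat) (D : nat -> nat -> nat),
    [/\ forall m n c : nat, (0 < F m n c)%N,
        forall n c : nat, (0 < D n c)%N &
        forall (m n c : nat) (G : groupType) (g : G),
          (1 <= n)%N ->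
          locally_finite G ->
          has_order g (2 ^ n)%N ->
          (centralizer g #= `I_m)%card ->
          nilpotent_of_class (centralizer (g ^+ (2 ^ n.-1)%N)%g) c ->
          exists H : set G,
            [/\ is_subgroup H,
                characteristic H,
                soluble H,
                (exists2 k : nat, has_index H k & (k <= F m n c)%N) &
                (exists2 d : nat, has_derived_length H d & (d <= D n c)%N)]].
Proof.
(* The successor makes the bound positive also when m = 0. *)
exists (fun m _ c => (index_bound (m ^ c)).+1), (fun _ _ => 2); split=> //.
move=> m n c G g n_gt0 lfG [_ g1 _] /at_most_card_eq Cg [Nc _].
set t := g ^+ _ in Nc *.
have t2 : t ^+ 2 = 1 by rewrite -expgM -expnSr prednK.
have Ct : at_most (m ^ c) (centralizer t).
  apply: at_most_nilpotent Nc _ Cg.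
  by apply: commute_sym; apply: commuteX.
have [V [sgV charV V2 [k Vk kM]]] := small_involution_centralizer lfG t2 Ct.
exists V; split=> //.
- by exists 2.
- by exists k => //; apply: leqW.
- exact: has_derived_length_leq.
Qed.
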